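(* Let $q=2^m$ with $m>1$ odd. Every Buekenhout–Tits unital in $\mathrm{PG}(2,q^2)$ contains an O'Nan configuration.
   Context: A unital embedded in a projective plane of order $q^2$ is a set $\mathcal U$ of $q^3+1$ points such that every line meets $\mathcal U$ in exactly $1$ or $q+1$ points. An O'Nan configuration in $\mathcal U$ consists of four distinct lines which pairwise intersect in six distinct points, all lying in $\mathcal U$. A Buekenhout–Tits unital in $\mathrm{PG}(2,q^2)$ is obtained in the Bruck–Bose model of $\mathrm{PG}(2,q^2)$ (affine points of $\mathrm{PG}(4,q)$ off a hyperplane $\Sigma_\infty$ together with the lines of a regular spread $\mathcal S$ of $\Sigma_\infty$) as the set of points of a cone, with vertex a point, over a Tits ovoid, the cone meeting $\Sigma_\infty$ in a line of $\mathcal S$. Equivalently, it is a set projectively equivalent to $\mathcal U_T=\{(0,1,0)\}\cup\{(x_0+x_1\delta,\ r+f(x_0,x_1)\delta,\ 1): x_0,x_1,r\in\mathbb F_q\}$, where $\delta\in\mathbb F_{q^2}\setminus\mathbb F_q$, $f(x_0,x_1)=x_0^{\tau+2}+x_0x_1+x_1^{\tau}$ and $\tau=2^{(m+1)/2}$. *)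

(* Defs.v *)
From HB Require Import structures.
From mathcomp Require Import all_boot all_order all_algebra.

Set Implicit Arguments.
Unset Strict Implicit.
Unset Printing Implicit Defensive.

Import GRing.Theory.
Local Open Scope ring_scope.

(* The projective space of a vector space V consists of its subspaces, with   *)
(* incidence (_ <= _)%VS; dimensions are those of the underlying vector       *)
(* spaces, so that a point has dimension 1.  PG(n, F) is that of 'rV[F]_n.+1. *)
Definition subspaces (F : fieldType) (V : vectType F) := {vspace V} -> Prop.

Section Incidence.
Variables (F : fieldType) (V : vectType F).
Implicit Types (P l t A B C X Y H W v : {vspace V}) (S O : subspaces V).

Definition is_point P := \dim P = 1%N.
Definition is_line l := \dim l = 2%N.
Definition is_plane Y := \dim Y = 3%N.
Definition is_hyperplane H := (\dim H).+1 = \dim {:V}.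

Definition meets l t : Prop := (l :&: t)%VS <> 0%VS.

Definition is_spread H S :=
  (forall l, S l -> is_line l /\ (l <= H)%VS) /\
  (forall P, is_point P -> (P <= H)%VS -> exists! l, S l /\ (P <= l)%VS).

(* For pairwise skew lines A, B, C of the 3-space H: the lines of H meeting   *)
(* every transversal of A, B, C.                                              *)
Definition regulus H A B C l :=
  [/\ is_line l, (l <= H)%VS
    & forall t, is_line t -> (t <= H)%VS ->
        meets t A -> meets t B -> meets t C -> meets t l].

Definition is_regular_spread H S :=
  is_spread H S /\
  (forall A B C, S A -> S B -> S C -> A <> B -> A <> C -> B <> C ->
     forall l, regulus H A B C l -> S l).

(* The Bruck-Bose plane of (H, S): its points are the affine points (those    *)
(* not in H) and the spread lines; its lines are the planes not in H that     *)
(* meet H in a spread line, and the line at infinity, represented by H.       *)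
(* With this encoding, incidence is (_ <= _)%VS in all cases.                 *)
Definition bb_point H S X := (is_point X /\ ~ (X <= H)%VS) \/ S X.

Definition bb_line H S Y :=
  [/\ is_plane Y, ~ (Y <= H)%VS & S (Y :&: H)%VS] \/ Y = H.

Definition cone v O P :=
  is_point P /\ exists2 Q, O Q & (P <= v + Q)%VS.

End Incidence.

(* beta identifies the points of the projective plane of V3 with those of the *)
(* Bruck-Bose plane of (H, S), lines corresponding to lines; its values on    *)
(* subspaces that are not points are irrelevant.                              *)
Definition bb_model (K F : fieldType) (V3 : vectType K) (V : vectType F)
    (H : {vspace V}) (S : subspaces V) (beta : {vspace V3} -> {vspace V}) :=
  [/\ forall P, is_point P -> bb_point H S (beta P),
      forall P Q, is_point P -> is_point Q -> beta P = beta Q -> P = Q,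
      forall X, bb_point H S X -> exists2 P, is_point P & beta P = X,
      forall l, is_line l -> exists2 Y, bb_line H S Y &
        forall P, is_point P -> (P <= l)%VS = (beta P <= Y)%VS
    & forall Y, bb_line H S Y -> exists2 l, is_line l &
        forall P, is_point P -> (P <= l)%VS = (beta P <= Y)%VS].

Section TitsOvoid.
Variables (F : fieldType) (m : nat).

Definition tits_exp : nat := 2 ^ (m.+1)./2.

Definition tits_f (x0 x1 : F) : F :=
  x0 ^+ (tits_exp + 2) + x0 * x1 + x1 ^+ tits_exp.

Definition row4 (a b c d : F) : 'rV[F]_4 :=
  \row_(i < 4) nth 0 [:: a; b; c; d] i.

Definition standard_tits_ovoid : subspaces 'rV[F]_4 := fun P =>
  P = <[row4 0 0 1 0]>%VS \/
  exists x0 x1, P = <[row4 x0 x1 (tits_f x0 x1) 1]>%VS.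

(* O is the image of the standard Tits ovoid under an isomorphism phi from    *)
(* F^4 onto the 3-space W.                                                    *)
Definition is_tits_ovoid (V : vectType F) (W : {vspace V}) (O : subspaces V) :=
  exists phi : 'Hom('rV[F]_4, V),
    [/\ lker phi = 0%VS, limg phi = W
      & forall P, O P <-> exists2 Q, standard_tits_ovoid Q & P = (phi @: Q)%VS].

End TitsOvoid.

(* A Buekenhout-Tits unital U in PG(2, K), where |F| = q = 2 ^ m and          *)
(* |K| = q ^ 2, in terms of a Bruck-Bose model (H, S, beta) of PG(2, K) in    *)
(* PG(4, F) and of the cone with vertex v over the Tits ovoid O of W, which   *)
(* meets the hyperplane at infinity H in the spread line l.                   *)
Definition is_buekenhout_tits_unital (F K : fieldType) (m : nat)
    (U : subspaces 'rV[K]_3) :=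
  exists (H : {vspace 'rV[F]_5}) (S : subspaces 'rV[F]_5)
         (beta : {vspace 'rV[K]_3} -> {vspace 'rV[F]_5})
         (W : {vspace 'rV[F]_5}) (O : subspaces 'rV[F]_5)
         (v l : {vspace 'rV[F]_5}),
    [/\ is_hyperplane H, is_regular_spread H S & bb_model H S beta] /\
    [/\ is_hyperplane W, is_tits_ovoid m W O, is_point v & ~ (v <= W)%VS] /\
    [/\ S l,
        forall P, is_point P -> (cone v O P /\ (P <= H)%VS <-> (P <= l)%VS)
      & forall P, U P <->
          is_point P /\
          ((cone v O (beta P) /\ ~ (beta P <= H)%VS) \/ beta P = l)].

(* Four distinct lines, the pairwise intersections of which are six distinct  *)
(* points of U.                                                               *)
Definition contains_ONan_configuration (K : fieldType)
    (U : subspaces 'rV[K]_3) :=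
  exists L : 'I_4 -> {vspace 'rV[K]_3},
    [/\ injective L,
        forall i, is_line (L i),
        forall i j : 'I_4, (i < j)%N ->
          is_point (L i :&: L j)%VS /\ U (L i :&: L j)%VS
      & forall i j k l : 'I_4, (i < j)%N -> (k < l)%N ->
          (L i :&: L j)%VS = (L k :&: L l)%VS -> i = k /\ j = l].

(* Main.v *)
Require Import Defs.
From mathcomp Require Import all_boot all_order all_algebra all_field ring zify.

(**
  Everything takes place in PG(4, F).  The vertex of the cone lies on the
  spread line l, and H is tangent at the only point of the ovoid in H; by the
  symmetries of the Tits ovoid this may be the point (0, 0, 1, 0), so that the
  affine points of the unital are the vectors
    r w + x0 u0 + x1 u1 + f(x0, x1) u2 + u3,  with l = <w, u2>.
  The reguli through l force the other spread lines to be the lines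
  <u1 + z, u0 + c + J z> for z in l, where J is a linear endomorphism of l
  without eigenvectors; hence J has nonzero trace T, as squaring is onto.

  A line of the plane is therefore y = M x + d with M in this affine family,
  and projecting a complete quadrilateral along l yields six abscissae whose
  opposite pairs are exchanged by an involution.  Taking for it the translation
  by (x0, x1) = (0, 1), along which f is affine, and the abscissae
    (0, 0), (0, b), (c, 0), (c, 1), (0, b + 1), (0, 1),
  the six conditions for the vertices to lie on the unital reduce to
    k c (1 + b) = 1 + b^(tau - 1)  and  k (1 + T c) = 1.
  These are solved by rational functions of b, subject only to b avoiding the
  roots of a polynomial of degree tau < q.
*)

Set Implicit Arguments.
Unset Strict Implicit.
Unset Printing Implicit Defensive.

Import GRing.Theory.
Local Open Scope ring_scope.

(** * Arithmetic of the Tits function *)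

Lemma addr_eq0_two0 (R : comNzRingType) (x y : R) :
  2 = 0 :> R -> x + y = 0 -> x = y.
Proof.
move=> two0 /eqP; rewrite addr_eq0 => /eqP ->.
by apply/eqP; rewrite -subr_eq0 -opprD -mulr2n -mulr_natr two0 mulr0 oppr0.
Qed.

Lemma even_eq0_two0 (R : comNzRingType) (n : nat) :
  2 = 0 :> R -> (n * 2)%:R = 0 :> R.
Proof. by move=> two0; rewrite natrM two0 mulr0. Qed.

(* [ring: h] with [h : n = 0] only discards the coefficients equal to [n], so
   that the small even numbers are listed one by one. *)
Ltac ring2 h :=
  apply: (addr_eq0_two0 h);
  ring: h (even_eq0_two0 2 h : 4 = 0) (even_eq0_two0 3 h : 6 = 0)
        (even_eq0_two0 4 h : 8 = 0).

Section TitsFunction.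

Variables (F : finFieldType) (m : nat).
Hypotheses (m_gt1 : (1 < m)%N) (odd_m : odd m) (cardF : #|F| = (2 ^ m)%N).

Local Notation tau := (tits_exp m).
Local Notation f := (@tits_f F m).

Lemma card_pow2_pchar : 2 \in [pchar F].
Proof. exact: (card_finPcharP cardF). Qed.

Let two0 : 2 = 0 :> F.
Proof. exact: (pcharf0 card_pow2_pchar). Qed.

Lemma exp_titsD (x y : F) : (x + y) ^+ tau = x ^+ tau + y ^+ tau.
Proof.
apply: exprDn_pchar; rewrite /tits_exp pnatX; apply/orP; left.
by rewrite pnatE // card_pow2_pchar.
Qed.

(** Since [m] is odd, [tau ^ 2 = 2 ^ (m + 1) = 2 q], and [x ^ q = x]. *)
Lemma exp_tits_tits (x : F) : (x ^+ tau) ^+ tau = x ^+ 2.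
Proof.
rewrite -exprM /tits_exp -expnD addnn -[X in (2 ^ X)%N]odd_double_half.
rewrite odd_double add0n half_double -mul2n.
have -> : (2 * m.+1./2 = m.+1)%N.
  by rewrite -[RHS]odd_double_half /= odd_m add0n mul2n.
by rewrite expnSr exprM -cardF expf_card.
Qed.


Lemma tits_fE (x y : F) : f x y = x ^+ tau * x ^+ 2 + x * y + y ^+ tau.
Proof. by rewrite /tits_f exprD. Qed.

Lemma exp_tits0 : (0 : F) ^+ tau = 0.
Proof. by rewrite expr0n expn_eq0. Qed.

Lemma tits_f00 : f 0 0 = 0.
Proof. by rewrite tits_fE exp_tits0 !mul0r !addr0. Qed.

(** The correction terms are affine in [(x, y)], so a linear change of coordinates absorbs them; the
    resulting symmetries are transitive on the ovoid points other than [(0, 0, 1, 0)]. *)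
Lemma tits_f_translate (a b x y : F) :
  f (x + a) (y + b + a ^+ tau * x) =
  f x y + f a b + (b + a ^+ tau * a) * x + a * y.
Proof. rewrite !tits_fE !exp_titsD exprMn exp_tits_tits.
ring2 two0. Qed.

Lemma tits_f_exp (x y : F) :
  f x y ^+ tau = x ^+ 2 * (x ^+ tau) ^+ 2 + x ^+ tau * y ^+ tau + y ^+ 2.
Proof. rewrite tits_fE !exp_titsD !exprMn !exp_tits_tits; ring. Qed.

(** The involution [(x, y, z, 1) -> (y, x, 1, z)] preserves the ovoid; here its image is rescaled to
    last coordinate 1. *)
Lemma tits_f_invert (x y : F) : f x y != 0 ->
  f (y / f x y) (x / f x y) = (f x y)^-1.
Proof.
move=> z0; rewrite tits_fE !exprMn !exprVn.
have zt0 : f x y ^+ tau != 0 by rewrite expf_neq0.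
(* The claim with its denominators cleared. *)
suff E : y ^+ tau * y ^+ 2 + x * y * f x y ^+ tau + x ^+ tau * f x y ^+ 2
         = f x y ^+ tau * f x y.
  have E2 : f x y ^+ tau * f x y ^+ 2 != 0 by rewrite mulf_neq0 ?expf_neq0.
  apply: (mulfI E2); transitivity (f x y ^+ tau * f x y); last by field.
  by rewrite -E; field; rewrite zt0 z0.
rewrite tits_f_exp tits_fE; ring2 two0.
Qed.

Lemma tits_f_eq0 (x y : F) : f x y = 0 -> x = 0 /\ y = 0.
Proof.
move=> fxy; have y0 : y = 0.
  (* The identity behind [tits_f_invert], rearranged: each term on the right vanishes with
     [f x y]. *)
  have : y ^+ tau * y ^+ 2 = f x y ^+ tau * f x y
     + x * y * f x y ^+ tau + x ^+ tau * f x y ^+ 2.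
    rewrite tits_f_exp tits_fE; ring2 two0.
  rewrite fxy exp_tits0 expr0n /= !mulr0 !addr0 => /eqP.
  by rewrite mulf_eq0 !expf_eq0 => /orP[] /andP[_ /eqP].
split=> //; move: fxy; rewrite tits_fE y0 exp_tits0 mulr0 !addr0 => /eqP.
by rewrite mulf_eq0 !expf_eq0 => /orP[] /andP[_ /eqP].
Qed.

(** Applying the power [tau] twice squares [b], so a fixed [b] is idempotent. *)
Lemma exp_tits_fix (b : F) : b ^+ tau = b -> b = 0 \/ b = 1.
Proof.
move=> bb; have := exp_tits_tits b; rewrite !bb => /eqP.
rewrite eq_sym -subr_eq0 expr2 -{3}[b]mulr1 -mulrBr mulf_eq0 subr_eq0.
by case/orP=> /eqP; [left | right].
Qed.

Lemma pchar2_sqrt (a : F) : exists x, x ^+ 2 = a.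
Proof.
by exists ((a ^+ (2 ^ m.-1))); rewrite -exprM -expnSr prednK ?(ltnW m_gt1) // -cardF expf_card.
Qed.

Lemma tits_exp_bounds : (3 < tau < #|F|)%N.
Proof.
rewrite cardF /tits_exp -[4%N]/(2 ^ 2)%N leq_exp2l // ltn_exp2l //.
(* Here [m >= 3], whence [2 <= (m + 1) / 2 < m]. *)
by case: m m_gt1 odd_m => [|[|[|n]]] // _ _; lia.
Qed.

(* Otherwise the polynomial [T X^tau + (T + 1) X + X^2], of degree [tau < q],
   would vanish on all of [F]. *)
Lemma tits_exp_avoid (T : F) : T != 0 ->
  exists b, [/\ b != 0, b != 1 & T * (b ^+ tau + b) + b + b ^+ 2 != 0].
Proof.
move=> T0; have /andP[tau3 tauq] := tits_exp_bounds.
pose p : {poly F} := T *: 'X^tau + ((T + 1) *: 'X + 'X^2).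
have sp : size p = tau.+1.
  rewrite size_polyDl size_scale // size_polyXn //.
  rewrite (leq_ltn_trans (size_polyD _ _)) // gtn_max size_polyXn.
  by rewrite (leq_ltn_trans (size_scale_leq _ _)) ?size_polyX; lia.
have /negP pF : ~~ all (root p) (enum F).
  apply: contraL tauq => allp; rewrite -leqNgt -ltnS -sp cardE.
  by apply: max_poly_roots; rewrite ?enum_uniq // -size_poly_eq0 sp.
have [b pb] : exists b, ~~ root p b.
  apply/existsP; rewrite -negb_forall; apply/negP => /forallP h.
  by apply: pF; apply/allP => x _.
have pE : T * (b ^+ tau + b) + b + b ^+ 2 = p.[b].
  by rewrite !hornerE /=; ring.
exists b; split; [apply: contraNneq pb => b0 | apply: contraNneq pb => b1 |].
- by rewrite rootE -pE b0 exp_tits0 expr0n /= !addr0 mulr0.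
- by rewrite rootE -pE b1 !expr1n; apply/eqP; ring2 two0.
by rewrite pE -rootE.
Qed.

End TitsFunction.

(** * Subspaces and the Bruck-Bose model *)

Section Subspaces.

Variables (F : fieldType) (V : vectType F).
Implicit Types (x y p : V) (A H l P : {vspace V}).

Lemma vline_is_point x : x != 0 -> is_point <[x]>%VS.
Proof. by move=> x0; rewrite /is_point dim_vline x0. Qed.

Lemma is_pointP P : is_point P -> exists2 x, x != 0 & P = <[x]>%VS.
Proof.
move=> P1; have P0 : P != 0%VS by rewrite -dimv_eq0 P1.
exists (vpick P); first by rewrite vpick0.
apply/eqP; rewrite eq_sym eqEdim -memvE memv_pick /= P1 dim_vline.
by rewrite vpick0 P0.
Qed.

Lemma vline_sub x A : (<[x]> <= A)%VS = (x \in A).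
Proof. by rewrite memvE. Qed.

Lemma span2_is_line x y :
    (forall a b : F, a *: x + b *: y = 0 -> a = 0 /\ b = 0) ->
  is_line (<[x]> + <[y]>)%VS.
Proof.
move=> ind; have x0 : x != 0.
  apply/eqP=> x0; have [|/eqP] := ind 1 0; first by rewrite x0 scaler0 scale0r addr0.
  by rewrite oner_eq0.
have y0 : y != 0.
  apply/eqP=> y0; have [|_ /eqP] := ind 0 1; first by rewrite y0 scaler0 scale0r addr0.
  by rewrite oner_eq0.
rewrite /is_line dimv_disjoint_sum ?dim_vline ?x0 ?y0 //.
apply/eqP; rewrite -subv0; apply/subvP=> z; rewrite memv_cap memv0.
case/andP=> /vlineP[a ->] /vlineP[b /eqP]; rewrite -subr_eq0 -scaleNr => /eqP.
by case/ind=> -> _; rewrite scale0r.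
Qed.

Lemma is_line_span l x y : is_line l -> x \in l -> y \in l ->
    (forall a b : F, a *: x + b *: y = 0 -> a = 0 /\ b = 0) ->
  l = (<[x]> + <[y]>)%VS.
Proof.
move=> l2 xl yl ind; apply/eqP; rewrite eq_sym eqEdim subv_add -!memvE xl yl /=.
by rewrite l2 span2_is_line.
Qed.

Lemma span2P x y z :
  reflect (exists a b : F, z = a *: x + b *: y) (z \in (<[x]> + <[y]>)%VS).
Proof.
apply: (iffP memv_addP) => [[_ /vlineP[a ->] [_ /vlineP[b ->] ->]]|[a [b ->]]].
  by exists a, b.
exists (a *: x); first by rewrite memvZ ?memv_line.
by exists (b *: y); rewrite ?memvZ ?memv_line.
Qed.

Lemma affine_plane_dim p A H : p \notin H -> is_line A -> (A <= H)%VS ->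
  is_plane (<[p]> + A)%VS.
Proof.
move=> pH A2 AH; rewrite /is_plane dimv_disjoint_sum.
  by rewrite A2 dim_vline; case: eqVneq pH => // ->; rewrite mem0v.
apply/eqP; rewrite -subv0; apply/subvP=> z; rewrite memv_cap memv0.
case/andP=> /vlineP[a ->] /(subvP AH); rewrite rpredZeq.
by case: eqVneq => [->|_ /= pH']; rewrite ?scale0r // pH' in pH *.
Qed.

Lemma affine_plane_cap p A H : p \notin H -> is_line A -> (A <= H)%VS ->
  ((<[p]> + A) :&: H)%VS = A.
Proof.
move=> pH A2 AH; apply/eqP; rewrite eq_sym eqEdim subv_cap addvSr AH /= A2.
have := affine_plane_dim pH A2 AH; rewrite /is_plane => Y3.
rewrite leqNgt; apply: contra pH => d3.
have : ((<[p]> + A) :&: H)%VS == (<[p]> + A)%VS.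
  by rewrite eqEdim capvSl Y3.
move/eqP/capv_idPl; rewrite subv_add -memvE; by case/andP.
Qed.

Lemma hyperplane_complement p H x : is_hyperplane H -> p \notin H ->
  exists c, x - c *: p \in H.
Proof.
move=> Hh pH; have p0 : p != 0 by apply: contraNneq pH => ->; rewrite mem0v.
have E : (H + <[p]>)%VS = fullv.
  apply/eqP; rewrite eqEdim subvf -Hh dimv_disjoint_sum.
    by rewrite dim_vline p0 addn1 leqnn.
  apply/eqP; rewrite -subv0; apply/subvP=> z; rewrite memv_cap memv0.
  case/andP=> zH /vlineP[a za]; move: zH; rewrite za rpredZeq (negPf pH) orbF.
  by move/eqP->; rewrite scale0r.
have : x \in (H + <[p]>)%VS by rewrite E memvf.
case/memv_addP=> h hH [_ /vlineP[c ->] ->]; exists c.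
by rewrite addrK.
Qed.

End Subspaces.

Lemma cap_lines_is_point (K : fieldType) (l t : {vspace 'rV[K]_3}) :
  is_line l -> is_line t -> l <> t -> is_point (l :&: t)%VS.
Proof.
move=> l2 t2 lt; have := dimv_sum_cap l t; rewrite l2 t2.
have s3 : (\dim (l + t) <= 3)%N.
  by rewrite (leq_trans (dimvS (subvf _))) // dimvf /dim /= mul1n.
have c1 : (\dim (l :&: t) < 2)%N.
  rewrite ltnNge; apply/negP=> c2; apply: lt.
  have c : (l :&: t)%VS = l by apply/eqP; rewrite eqEdim capvSl l2.
  by apply/eqP; rewrite eqEdim l2 t2 leqnn andbT; apply/capv_idPl.
rewrite /is_point; lia.
Qed.

(** * Pulling a configuration back from the Bruck-Bose plane *)

Section PullBack.

Variables (F K : fieldType) (V : vectType F) (U : subspaces 'rV[K]_3).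
Variables (H : {vspace V}) (S : subspaces V).
Variable beta : {vspace 'rV[K]_3} -> {vspace V}.
Hypotheses (Hspread : is_spread H S) (model : bb_model H S beta).
Variables (A : 'I_4 -> {vspace V}) (p : 'I_4 -> V) (x : 'I_4 -> 'I_4 -> V).
Hypotheses (A_S : forall i, S (A i)) (A_inj : injective A).
Hypothesis pH : forall i, p i \notin H.
Hypothesis x_on : forall i j : 'I_4, (i < j)%N ->
  x i j - p i \in A i /\ x i j - p j \in A j.
Hypothesis x_inj : forall i j k l : 'I_4, (i < j)%N -> (k < l)%N ->
  <[x i j]>%VS = <[x k l]>%VS -> i = k /\ j = l.
Hypothesis x_U : forall (i j : 'I_4) P, (i < j)%N ->
  is_point P -> beta P = <[x i j]>%VS -> U P.

(** The planes [p i + A i] are Bruck-Bose lines, and their preimages are the four lines wanted. As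
    [beta] is constrained on points only, lines are compared through their affine points. *)
Lemma ONan_of_spread_lines : contains_ONan_configuration U.
Proof.
have [_ beta_inj beta_surj model_l model_Y] := model.
have A2 i : is_line (A i) by have [/(_ _ (A_S i))[]] := Hspread.
have AH i : (A i <= H)%VS by have [/(_ _ (A_S i))[]] := Hspread.
pose Y i := (<[p i]> + A i)%VS.
have YH i : (Y i :&: H)%VS = A i by exact: affine_plane_cap.
have bbY i : bb_line H S (Y i).
  left; split; [exact: affine_plane_dim (AH i) | | by rewrite YH].
  by rewrite subv_add -memvE => /andP[]; rewrite (negPf (pH i)).
have [L L2 LY] := fin_all_exists2 (fun i => model_Y _ (bbY i)).
have bbx y : y \notin H -> exists2 P, is_point P & beta P = <[y]>%VS.
  move=> yH; apply: beta_surj; left; rewrite vline_sub; split; last exact/negP.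
  by apply: vline_is_point; apply: contraNneq yH => ->; rewrite mem0v.
have L_inj : injective L.
  move=> i j Lij; apply: A_inj; apply/eqP; rewrite eqEdim !A2 leqnn andbT.
  apply/subvP=> d dA; rewrite -YH memv_cap (subvP (AH i)) // andbT.
  (* Differences of such affine points show that [A i] lies in [Y j :&: H = A j]. *)
  have on e : e \in A i -> p i + e \in Y j.
    move=> eA; have : p i + e \notin H by rewrite rpredDr ?pH ?(subvP (AH i)).
    case/bbx=> P P1 bP; rewrite memvE -bP -LY // -Lij LY // bP -memvE.
    by rewrite memv_add ?memv_line.
  by rewrite -[d](addKr (p i)) addrC rpredB ?on // -[p i]addr0 on ?mem0v.
have Px (i j : 'I_4) : (i < j)%N ->
    is_point (L i :&: L j)%VS /\ beta (L i :&: L j)%VS = <[x i j]>%VS.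
  move=> ij; have Lij : is_point (L i :&: L j)%VS.
    by apply: cap_lines_is_point => // /L_inj E; rewrite E ltnn in ij.
  split=> //; have [xi xj] := x_on ij.
  have xH : x i j \notin H.
    by rewrite -(subrK (p i) (x i j)) rpredDl ?pH ?(subvP (AH i)).
  have xY k : x i j - p k \in A k -> x i j \in Y k.
    by move=> h; rewrite -(subrKC (p k) (x i j)) memv_add ?memv_line.
  have [P P1 bP] := bbx _ xH.
  have -> // : (L i :&: L j)%VS = P.
  apply/eqP; rewrite eq_sym eqEdim Lij P1 leqnn andbT subv_cap.
  by rewrite !LY // bP !vline_sub !xY.
exists L; split=> // [i j ij|i j k l ij kl E].
  by have [P1 bP] := Px _ _ ij; split=> //; apply: x_U bP.
have [_ b1] := Px _ _ ij; have [_ b2] := Px _ _ kl.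
by apply: x_inj => //; rewrite -b1 -b2 E.
Qed.

End PullBack.

(** * Regular spreads *)

Ltac vring := apply/rowP => ?; rewrite !mxE; ring.

Definition independent5 (F : fieldType) (V : lmodType F) (w u0 u1 u2 u3 : V) :=
  forall r a b c d : F, r *: w + a *: u0 + b *: u1 + c *: u2 + d *: u3 = 0 ->
    [/\ r = 0, a = 0, b = 0, c = 0 & d = 0].

Lemma spread_line_uniq (F : fieldType) (V : vectType F) (H : {vspace V}) S A B x :
  is_spread H S -> S A -> S B -> x != 0 -> x \in A -> x \in B -> A = B.
Proof.
move=> [SH Suniq] SA SB x0 xA xB.
have xH : (<[x]> <= H)%VS by rewrite vline_sub (subvP (SH _ SA).2).
have [C [_ CE]] := Suniq _ (vline_is_point x0) xH.
by rewrite -(CE A) ?(CE B) ?vline_sub.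
Qed.

Section SpreadSet.

Variables (F : fieldType) (H l : {vspace 'rV[F]_5}) (S : subspaces 'rV[F]_5).
Variables w u0 u1 u2 u3 : 'rV[F]_5.
Hypotheses (ind : independent5 w u0 u1 u2 u3) (hypH : is_hyperplane H).
Hypotheses (regS : is_regular_spread H S) (Sl : S l).
Hypotheses (wl : w \in l) (u2l : u2 \in l) (u0H : u0 \in H) (u1H : u1 \in H).

Let spreadS : is_spread H S. Proof. by case: regS. Qed.

Let H4 : \dim H = 4%N.
Proof. by move: hypH; rewrite /is_hyperplane dimvf dim_matrix => -[]. Qed.

Let lH : (l <= H)%VS. Proof. by have [/(_ _ Sl)[]] := spreadS. Qed.

Let lE : l = (<[w]> + <[u2]>)%VS.
Proof.
apply: is_line_span => //; first by have [/(_ _ Sl)[]] := spreadS.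
move=> a b E; have [] := @ind a 0 0 b 0 => //; rewrite -[RHS]E; vring.
Qed.

Definition inf_vec (z1 z2 : F) := z1 *: w + z2 *: u2.

(* The line of [H] skew to [l] that is the graph of [u1 |-> z], [u0 |-> y]. *)
Definition graph_line (z1 z2 y1 y2 : F) :=
  (<[u1 + inf_vec z1 z2]> + <[u0 + inf_vec y1 y2]>)%VS.

Lemma inf_vec_l z1 z2 : inf_vec z1 z2 \in l.
Proof. by rewrite lE; apply/span2P; exists z1, z2. Qed.

Lemma graph_ind z1 z2 y1 y2 (a b c d : F) :
  a *: (u1 + inf_vec z1 z2) + b *: (u0 + inf_vec y1 y2) + inf_vec c d = 0 ->
  [/\ a = 0, b = 0, c = 0 & d = 0].
Proof.
move=> E; have [|e1 e2 e3 e4 _] := @ind (a * z1 + b * y1 + c) b a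
   (a * z2 + b * y2 + d) 0; first by rewrite -[RHS]E /inf_vec; vring.
by move: e1 e4; rewrite e2 e3 !mul0r !add0r.
Qed.

Lemma graph_ind2 z1 z2 y1 y2 (a b : F) :
  a *: (u1 + inf_vec z1 z2) + b *: (u0 + inf_vec y1 y2) = 0 -> a = 0 /\ b = 0.
Proof.
move=> E; have [|//] := @graph_ind z1 z2 y1 y2 a b 0 0.
by rewrite E /inf_vec !scale0r !addr0.
Qed.

Lemma graph_vec_neq0 z1 z2 : u1 + inf_vec z1 z2 != 0.
Proof.
apply/eqP=> E; have [|/eqP] := @graph_ind2 z1 z2 0 0 1 0.
  by rewrite E scaler0 scale0r addr0.
by rewrite oner_eq0.
Qed.

Lemma graph_line_cap z1 z2 y1 y2 x :
  x \in graph_line z1 z2 y1 y2 -> x \in l -> x = 0.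
Proof.
rewrite lE => /span2P[a [b ->]] /span2P[c [d E]].
have [|-> -> _ _] := @graph_ind z1 z2 y1 y2 a b (- c) (- d).
  rewrite E /inf_vec; vring.
by rewrite !scale0r addr0.
Qed.

Lemma graph_line_neq z1 z2 y1 y2 : graph_line z1 z2 y1 y2 <> l.
Proof.
move=> E; have := graph_vec_neq0 z1 z2; apply/negP/negPn/eqP.
apply: (@graph_line_cap z1 z2 y1 y2); last rewrite -E.
  by rewrite (subvP (addvSl _ _)) ?memv_line.
by rewrite (subvP (addvSl _ _)) ?memv_line.
Qed.

Lemma graph_line_sub z1 z2 y1 y2 : (graph_line z1 z2 y1 y2 <= H)%VS.
Proof.
rewrite subv_add !vline_sub; apply/andP.
by split; apply: rpredD => //; rewrite (subvP lH) ?inf_vec_l.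
Qed.

Lemma graph_line_is_line z1 z2 y1 y2 : is_line (graph_line z1 z2 y1 y2).
Proof. apply: span2_is_line => a b; exact: graph_ind2. Qed.

Lemma graph_line_inj z1 z2 y1 y2 z1' z2' y1' y2' :
  graph_line z1 z2 y1 y2 = graph_line z1' z2' y1' y2' ->
  [/\ z1 = z1', z2 = z2', y1 = y1' & y2 = y2'].
Proof.
move=> E.
have : u1 + inf_vec z1 z2 \in graph_line z1' z2' y1' y2'.
  by rewrite -E (subvP (addvSl _ _)) ?memv_line.
have : u0 + inf_vec y1 y2 \in graph_line z1' z2' y1' y2'.
  by rewrite -E (subvP (addvSr _ _)) ?memv_line.
case/span2P=> a [b Ey] /span2P[c [d Ez]].
have [|c1 d0 e1 e2] := @graph_ind z1' z2' y1' y2' (c - 1) d (z1' - z1) (z2' - z2).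
  rewrite -[RHS](subrr (u1 + inf_vec z1 z2)) {1}Ez /inf_vec; vring.
have [|a0 b1 e3 e4] := @graph_ind z1' z2' y1' y2' a (b - 1) (y1' - y1) (y2' - y2).
  rewrite -[RHS](subrr (u0 + inf_vec y1 y2)) {1}Ey /inf_vec; vring.
by split; apply/esym/subr0_eq.
Qed.

(** The spread line through [u1 + z] differs from [l], hence is skew to it; together they span [H],
    so that this line contains a vector of [u0 + l]. *)
Lemma graph_line_exists z1 z2 : exists y1 y2, S (graph_line z1 z2 y1 y2).
Proof.
have [SH Suniq] := spreadS; have x0 := graph_vec_neq0 z1 z2.
have xH : (<[u1 + inf_vec z1 z2]> <= H)%VS.
  by rewrite vline_sub rpredD // (subvP lH) ?inf_vec_l.
have [A [[SA xA] _]] := Suniq _ (vline_is_point x0) xH.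
rewrite vline_sub in xA; have [A2 AH] := SH _ SA.
have Al0 : (A :&: l)%VS = 0%VS.
  apply/eqP; rewrite -subv0; apply/subvP=> x; rewrite memv_cap memv0.
  case/andP=> xA' xl; apply: contraT => xn0.
  have AE := spread_line_uniq spreadS SA Sl xn0 xA' xl.
  rewrite -(negPf x0); apply/eqP; apply: (@graph_line_cap z1 z2 0 0).
    by rewrite (subvP (addvSl _ _)) ?memv_line.
  by rewrite -AE.
have AlH : (A + l)%VS = H.
  apply/eqP; rewrite eqEdim subv_add AH lH /= dimv_disjoint_sum //.
  by rewrite H4 A2 (SH _ Sl).1.
have : u0 \in (A + l)%VS by rewrite AlH.
case/memv_addP=> a aA [b]; rewrite lE => /span2P[c [d ->]] E.
exists (- c), (- d).
have u0A : u0 + inf_vec (- c) (- d) \in A.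
  suff -> : u0 + inf_vec (- c) (- d) = a by [].
  by rewrite E /inf_vec; vring.
by rewrite /graph_line -(is_line_span A2 xA u0A) // => a' b'; apply: graph_ind2.
Qed.

(* The regulus through [l] and two graphs consists of [l] and of the graphs of
   the affine combinations of the two maps. *)
Lemma graph_line_regulus z1 z2 y1 y2 z1' z2' y1' y2' t :
  S (graph_line z1 z2 y1 y2) -> S (graph_line z1' z2' y1' y2') ->
  S (graph_line (z1 + t * (z1' - z1)) (z2 + t * (z2' - z2))
                (y1 + t * (y1' - y1)) (y2 + t * (y2' - y2))).
Proof.
set A := graph_line z1 _ _ _; set B := graph_line z1' _ _ _ => SA SB.
have [AB|/eqP AB] := eqVneq A B.
  by have [<- <- <- <-] := graph_line_inj AB; rewrite !subrr !mulr0 !addr0.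
have [_ /(_ l A B Sl SA SB)] := regS; apply=> //.
- by move=> E; apply: (@graph_line_neq z1 z2 y1 y2).
- by move=> E; apply: (@graph_line_neq z1' z2' y1' y2').
split; [exact: graph_line_is_line | exact: graph_line_sub | move=> T T2 TH].
have meetsP X : meets T X -> exists2 x, x != 0 & x \in T /\ x \in X.
  move=> TX; have : (T :&: X)%VS != 0%VS by apply/eqP.
  rewrite -vpick0 => n0; exists (vpick (T :&: X)%VS) => //.
  by have := memv_pick (T :&: X)%VS; rewrite memv_cap => /andP.
move=> /meetsP[c c0 [cT cl]] /meetsP[a a0 [aT aA]] /meetsP[b b0 [bT bB]].
(* Distinct spread lines [A] and [B] are skew, so [a] and [b] span the transversal [T]. *)
have abind (r s : F) : r *: a + s *: b = 0 -> r = 0 /\ s = 0.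
  move=> E; have E' : r *: a = - s *: b.
    by apply/eqP; rewrite scaleNr -subr_eq0 opprK E.
  have r0 : r = 0.
    apply/eqP; apply: contraT => r0; case: AB.
    apply: (spread_line_uniq spreadS SA SB a0 aA).
    by rewrite -[a](scalerK r0) E' scalerA memvZ.
  split=> //; move: E'; rewrite r0 scale0r scaleNr => /esym/eqP.
  by rewrite oppr_eq0 scaler_eq0 (negPf b0) orbF => /eqP.
have : c \in (<[a]> + <[b]>)%VS by rewrite -(is_line_span T2 aT bT abind).
case/span2P=> r [s cE].
(* Otherwise [c] would lie on one of the two graphs, which are skew to [l]. *)
have r0 : r != 0.
  apply: contraNneq c0 => r0; apply/eqP; apply: graph_line_cap cl.
  by rewrite cE r0 scale0r add0r memvZ // -/B; exact: bB.
have s0 : s != 0.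
  apply: contraNneq c0 => s0; apply/eqP; apply: graph_line_cap cl.
  by rewrite cE s0 scale0r addr0 memvZ // -/A; exact: aA.
have /span2P[a1 [a2 aE]] := aA; have /span2P[b1 [b2 bE]] := bB.
move: cl; rewrite lE => /span2P[c1 [c2 cE']].
have [|e1 e2 _ _] := @graph_ind 0 0 0 0 (r * a1 + s * b1) (r * a2 + s * b2)
  (r * (a1 * z1 + a2 * y1) + s * (b1 * z1' + b2 * y1') - c1)
  (r * (a1 * z2 + a2 * y2) + s * (b1 * z2' + b2 * y2') - c2).
  rewrite -[RHS](subrr c) {1}cE cE' aE bE /inf_vec; vring.
(* As [r *: a + s *: b] lies in [l], the vectors [b'] and [a] have the same [u1] and [u0]
   coefficients; hence [a + t *: (b' - a)], a vector of [T], lies on the interpolated graph. *)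
pose b' := (- s / r) *: b.
have b1E : (- s / r) * b1 = a1.
  by apply: (mulfI r0); rewrite -[RHS](addrK (s * b1)) e1; field.
have b2E : (- s / r) * b2 = a2.
  by apply: (mulfI r0); rewrite -[RHS](addrK (s * b2)) e2; field.
pose x := a + t *: (b' - a).
have xT : x \in T by rewrite rpredD // memvZ // rpredB // memvZ.
have xE : x = a1 *: (u1 + inf_vec (z1 + t * (z1' - z1)) (z2 + t * (z2' - z2)))
            + a2 *: (u0 + inf_vec (y1 + t * (y1' - y1)) (y2 + t * (y2' - y2))).
  rewrite /x; have -> : b' = a1 *: (u1 + inf_vec z1' z2') + a2 *: (u0 + inf_vec y1' y2').
    by rewrite /b' bE scalerDr !scalerA b1E b2E.
  rewrite aE /inf_vec; vring.
move=> TC0; have : x \in (T :&: graph_line (z1 + t * (z1' - z1))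
  (z2 + t * (z2' - z2)) (y1 + t * (y1' - y1)) (y2 + t * (y2' - y2)))%VS.
  by rewrite memv_cap xT; apply/span2P; exists a1, a2.
rewrite TC0 memv0 => /eqP; rewrite xE => /graph_ind2[a10 a20].
by move: a0; rewrite aE a10 a20 !scale0r addr0 eqxx.
Qed.

Hypothesis F_gt2 : exists t : F, t != 0 /\ t != 1.

(** The vector [c] and the columns of [J] are read off at [z = 0], [(1, 0)] and [(0, 1)], and the
    reguli give all other [z]. If [J z = lam z], the graphs at [0] and [z] share the vector
    [u0 + c - lam u1], hence coincide. *)
Lemma spread_set : exists j11 j12 j21 j22 c1 c2 : F,
  (forall z1 z2, S (graph_line z1 z2 (c1 + (j11 * z1 + j12 * z2))
                                     (c2 + (j21 * z1 + j22 * z2)))) /\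
  (forall lam z1 z2, j11 * z1 + j12 * z2 = lam * z1 ->
     j21 * z1 + j22 * z2 = lam * z2 -> z1 = 0 /\ z2 = 0).
Proof.
have [c1 [c2 S0]] := graph_line_exists 0 0.
have [a1 [a2 S1]] := graph_line_exists 1 0.
have [b1 [b2 S2]] := graph_line_exists 0 1.
exists (a1 - c1), (b1 - c1), (a2 - c2), (b2 - c2), c1, c2.
suff Sz z1 z2 : S (graph_line z1 z2 (c1 + ((a1 - c1) * z1 + (b1 - c1) * z2))
                            (c2 + ((a2 - c2) * z1 + (b2 - c2) * z2))).
  split=> // lam z1 z2 e1 e2; have := Sz z1 z2; rewrite e1 e2 => Sz12.
  have n0 : u0 + inf_vec c1 c2 - lam *: (u1 + inf_vec 0 0) != 0.
    apply/eqP=> E; have [|_ /eqP] := @graph_ind2 0 0 c1 c2 (- lam) 1.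
      rewrite -[RHS]E; vring.
    by rewrite oner_eq0.
  have EE := spread_line_uniq spreadS S0 Sz12 n0.
  have [||<- <- //] := graph_line_inj (EE _ _).
    by apply/span2P; exists (- lam), 1; vring.
  by apply/span2P; exists (- lam), 1; rewrite /inf_vec; vring.
(* The regulus property joins two graphs at a time: [z] is [1 - t] times a point of the first axis
   plus [t] times a point of the second. *)
have [t [t0 t1]] := F_gt2; have t1' : 1 - t != 0 by rewrite subr_eq0 eq_sym.
have Sr := graph_line_regulus (z1 / (1 - t)) S0 S1.
have Ss := graph_line_regulus (z2 / t) S0 S2.
have congrS x1 x2 y1 y2 x1' x2' y1' y2' :
    x1 = x1' -> x2 = x2' -> y1 = y1' -> y2 = y2' ->
    S (graph_line x1 x2 y1 y2) -> S (graph_line x1' x2' y1' y2').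
  by move=> -> -> -> ->.
by apply: congrS (graph_line_regulus t Sr Ss); field; rewrite ?t0 ?t1'.
Qed.

End SpreadSet.

(** If [j21 = 0], then [(1, 0)] is an eigenvector. If the trace vanishes, the characteristic
    polynomial is [X ^ 2 + det J], which has a root because every element is a square. *)
Lemma no_eigenvector_pchar2 (F : finFieldType) (m : nat) (j11 j12 j21 j22 : F) :
  (1 < m)%N -> #|F| = (2 ^ m)%N ->
  (forall lam z1 z2, j11 * z1 + j12 * z2 = lam * z1 ->
     j21 * z1 + j22 * z2 = lam * z2 -> z1 = 0 /\ z2 = 0) ->
  j21 != 0 /\ j11 + j22 != 0.
Proof.
move=> m_gt1 cardF noeig; have two0 := pcharf0 (card_pow2_pchar cardF).
have j21n0 : j21 != 0.
  apply/eqP=> j0; have [||/eqP] := noeig j11 1 0; rewrite ?j0 ?oner_eq0 //; ring.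
split=> //; apply/eqP=> tr0.
have [lam lamE] := pchar2_sqrt m_gt1 cardF (j11 * j22 + j12 * j21).
have jE : j22 = - j11 by apply/esym/addr0_eq.
(* This eigenvector is read off the second row of [J - lam]. *)
have [||_ /eqP] := noeig lam (lam + j22) j21.
- by apply: subr0_eq; rewrite [lam * _]mulrDr -expr2 lamE jE; ring: two0.
- by apply: subr0_eq; ring: two0.
by rewrite (negPf j21n0).
Qed.

(** * Coordinates of the configuration *)

(** Here [a = b ^ (tau - 1)]. The first equation determines the product [om = kap * c], and the
    second then gives [kap]. Only 0 and 1 are fixed by the power [tau], so [om != 0]; the choice of
    [b] ensures [kap != 0]. *)
Lemma ONan_parameters (F : finFieldType) (m : nat) (T : F) :
  (1 < m)%N -> odd m -> #|F| = (2 ^ m)%N -> T != 0 ->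
  exists a b c kap : F,
    [/\ b != 0, b != 1, c != 0 & kap != 0] /\
    [/\ b ^+ tits_exp m = b * a, kap * c * (1 + b) = 1 + a
      & kap + T * (kap * c) = 1].
Proof.
move=> m_gt1 odd_m cardF T0; have two0 := pcharf0 (card_pow2_pchar cardF).
have [b [b0 b1 avoid]] := tits_exp_avoid m_gt1 odd_m cardF T0.
set B := b ^+ _ in avoid.
have b1' : 1 + b != 0.
  by rewrite addrC addr_eq0 (oppr_pchar2 (card_pow2_pchar cardF)).
have BB : B + b != 0.
  rewrite addr_eq0 (oppr_pchar2 (card_pow2_pchar cardF)).
  apply/eqP=> /(exp_tits_fix odd_m cardF) [] /eqP; first exact/negP.
  exact/negP.
pose om := (B + b) / (b * (1 + b)); pose kap := 1 + T * om.
have bb0 : b * (1 + b) != 0 by rewrite mulf_neq0.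
have om0 : om != 0 by rewrite mulf_neq0 ?invr_eq0.
have kap0 : kap != 0.
  apply: contraNneq avoid => k0.
  have <- : b * (1 + b) * kap = T * (B + b) + b + b ^+ 2.
    by rewrite /kap /om; field; rewrite b0 b1'.
  by rewrite k0 mulr0.
exists (B / b), b, (om / kap), kap; split; split=> //.
- by rewrite mulf_neq0 ?invr_eq0.
- by rewrite mulrC divfK.
- by rewrite mulrC [kap * _]mulrC divfK // /om; field; rewrite b0 b1'.
- by rewrite [kap * _]mulrC divfK // {1}/kap; ring2 two0.
Qed.

Section Coordinates.

Variables (F : finFieldType) (m : nat).
Hypotheses (m_gt1 : (1 < m)%N) (odd_m : odd m) (cardF : #|F| = (2 ^ m)%N).
Variables j11 j12 j21 j22 c1 c2 : F.
Hypotheses (j21n0 : j21 != 0) (tr_n0 : j11 + j22 != 0).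

Let two0 := pcharf0 (card_pow2_pchar cardF).

(* Line [i] is [y = M_i x + d_i], where [M_i] maps [(x0, x1)] to
   [x1 z_i + x0 (c + J z_i)]; lines [i] and [j] meet above [x_ij]. *)
Lemma ONan_coordinates : exists (zr zs dr ds : nat -> F) (x0 x1 : nat -> nat -> F),
  [/\ forall i j, (i < j < 4)%N ->
        dr i + x1 i j * zr i + x0 i j * (c1 + (j11 * zr i + j12 * zs i)) =
        dr j + x1 i j * zr j + x0 i j * (c1 + (j11 * zr j + j12 * zs j)),
      forall i j, (i < j < 4)%N ->
        ds i + x1 i j * zs i + x0 i j * (c2 + (j21 * zr i + j22 * zs i)) =
        ds j + x1 i j * zs j + x0 i j * (c2 + (j21 * zr j + j22 * zs j)),
      forall i j, (i < j < 4)%N ->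
        ds i + x1 i j * zs i + x0 i j * (c2 + (j21 * zr i + j22 * zs i)) =
        tits_f m (x0 i j) (x1 i j),
      forall i j, (i < j < 4)%N -> zr i = zr j -> zs i <> zs j
    & forall i j k l, (i < j < 4)%N -> (k < l < 4)%N ->
        x0 i j = x0 k l -> x1 i j = x1 k l -> i = k /\ j = l].
Proof.
have [a [b [c [kap [[b0 b1 c0 kap0] [bt e1 e2]]]]]] :=
  ONan_parameters m_gt1 odd_m cardF tr_n0.
have [k kE k0] : exists2 k, kap = j21 * k & k != 0.
  by exists (kap / j21); rewrite ?mulf_neq0 ?invr_eq0 // mulrC divfK.
rewrite {}kE in e1 e2 kap0.
have [z0 z0E] : exists z, j21 * z = c ^+ tits_exp m * c + c2 + j22 * a.
  by exists ((c ^+ tits_exp m * c + c2 + j22 * a) / j21); rewrite mulrC divfK.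
have b1' : b + 1 != 0.
  by rewrite addr_eq0 (oppr_pchar2 (card_pow2_pchar cardF)).
pose zr i := z0 + nth 0 [:: 0; k * (1 + j11 * c) + k * b; k * (1 + j11 * c); k * (b + 1)] i.
pose zs i := a + nth 0 [:: 0; j21 * k * c; j21 * k * c; 0] i.
pose dr := nth 0 [:: 0; 0; b * (k * (1 + j11 * c)); c * (j11 * (k * (b + 1)))].
pose ds := nth 0 [:: 0; 0; b * (j21 * k * c); c * (j21 * (k * (b + 1)))].
(* Entries with [i >= j] are placeholders; the missing third row gives [x0 2 3 = 0] by default. *)
pose x0 i j := nth 0 (nth [::] [:: [:: 0; 0; 0; c]; [:: 0; 0; c; 0]] i) j.
pose x1 i j := nth 0 (nth [::] [:: [:: 0; 0; b; 0]; [:: 0; 0; 1; b + 1];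
                                   [:: 0; 0; 0; 1]] i) j.
have cases (P : nat -> nat -> Prop) : P 0 1 -> P 0 2 -> P 0 3 -> P 1 2 ->
    P 1 3 -> P 2 3 -> forall i j, (i < j < 4)%N -> P i j.
  by move=> ? ? ? ? ? ? [|[|[|i]]] [|[|[|[|j]]]] //; rewrite andbF.
have c2E : c2 = j21 * z0 + c ^+ tits_exp m * c + j22 * a by rewrite z0E; ring2 two0.
have aE : a = j21 * k * c * (1 + b) + 1 by rewrite e1; ring2 two0.
exists zr, zs, dr, ds, x0, x1; split.
- by apply: cases; rewrite /dr /zr /zs /x0 /x1 /=; ring2 two0.
- by apply: cases; rewrite /ds /zr /zs /x0 /x1 /=; ring2 two0.
- apply: cases; rewrite /ds /zr /zs /x0 /x1 /= tits_fE
    ?(exp_tits0, exp_titsD cardF, expr1n, bt) ?c2E.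
  + ring2 two0.
  + ring2 two0.
  + ring2 two0.
  + apply: (addr_eq0_two0 two0).
    transitivity ((j21 * k * c * (1 + b) + (1 + a))
      + c * (j21 * k + (j11 + j22) * (j21 * k * c) + 1)); first ring2 two0.
    rewrite e1 e2; ring2 two0.
  + rewrite aE; ring2 two0.
  + rewrite aE; ring2 two0.
- have kb : k * b != 0 by rewrite mulf_neq0.
  have kb1 : k * (b + 1) != 0 by rewrite mulf_neq0.
  have jkc : j21 * k * c != 0 by rewrite !mulf_neq0.
  apply: cases; rewrite /zr /zs /= => /addrI + /addrI; move=> /eqP + /eqP.
  all: rewrite ?(eq_sym 0) ?(negPf jkc) ?(negPf kb1) //.
  by rewrite -subr_eq0 addrAC subrr add0r (negPf kb).
have n1 : (1 == 0 :> F) = false by rewrite oner_eq0.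
have bb1 : (b + 1 == b) = false by rewrite -subr_eq0 addrAC subrr add0r n1.
have bb2 : (b + 1 == 1) = false by rewrite -subr_eq0 addrK (negPf b0).
move=> i j k' l ij kl; move: i j ij k' l kl.
apply: (cases); apply: (cases); rewrite /x0 /x1 /= => /eqP + /eqP //;
  by rewrite ?(eq_sym 0) ?(negPf c0) ?(negPf b0) ?(eq_sym 1 b) ?(eq_sym 1 (b + 1))
     ?(eq_sym b (b + 1)) ?n1 ?bb1 ?bb2 ?(negPf b1) ?(negPf b1').
Qed.

End Coordinates.

(** * The configuration in a frame adapted to the cone *)

Section Configuration.

Variables (m : nat) (F : finFieldType) (K : fieldType) (U : subspaces 'rV[K]_3).
Hypotheses (m_gt1 : (1 < m)%N) (odd_m : odd m) (cardF : #|F| = (2 ^ m)%N).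
Variables (H l : {vspace 'rV[F]_5}) (S : subspaces 'rV[F]_5).
Variable beta : {vspace 'rV[K]_3} -> {vspace 'rV[F]_5}.
Variables w u0 u1 u2 u3 : 'rV[F]_5.
Hypotheses (ind : independent5 w u0 u1 u2 u3) (hypH : is_hyperplane H).
Hypotheses (regS : is_regular_spread H S) (Sl : S l).
Hypothesis model : bb_model H S beta.
Hypotheses (wl : w \in l) (u2l : u2 \in l).
Hypotheses (u0H : u0 \in H) (u1H : u1 \in H) (u3H : u3 \notin H).
Hypothesis U_cone : forall P r x0 x1, is_point P ->
  beta P = <[r *: w + x0 *: u0 + x1 *: u1 + tits_f m x0 x1 *: u2 + u3]>%VS ->
  U P.

Lemma ONan_of_frame : contains_ONan_configuration U.
Proof.
have F_gt2 : exists t : F, t != 0 /\ t != 1.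
  have [b [b0 b1 _]] := tits_exp_avoid m_gt1 odd_m cardF (oner_neq0 F).
  by exists b.
have [j11 [j12 [j21 [j22 [c1 [c2 [Sz noeig]]]]]]] :=
  spread_set ind hypH regS Sl wl u2l u0H u1H F_gt2.
have [j21n0 tr_n0] := no_eigenvector_pchar2 m_gt1 cardF noeig.
have [zr [zs [dr [ds [x0 [x1 [meet_r meet_s on_f z_inj x_inj]]]]]]] :=
  ONan_coordinates m_gt1 odd_m cardF j12 c1 c2 j21n0 tr_n0.
pose yr i := c1 + (j11 * zr i + j12 * zs i).
pose ys i := c2 + (j21 * zr i + j22 * zs i).
pose A (i : 'I_4) := graph_line w u0 u1 u2 (zr i) (zs i) (yr i) (ys i).
pose p (i : 'I_4) := u3 + inf_vec w u2 (dr i) (ds i).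
(* The [w] coordinate is free on a cone with vertex [w]; it is taken from line [i], and [meet_r]
   gives the same value on line [j]. *)
pose x (i j : 'I_4) :=
  (dr i + x1 i j * zr i + x0 i j * yr i) *: w + x0 i j *: u0 + x1 i j *: u1
    + tits_f m (x0 i j) (x1 i j) *: u2 + u3.
have lt4 (i j : 'I_4) : (i < j)%N -> (i < j < 4)%N by move->; rewrite /=.
have lH : (l <= H)%VS by have [[/(_ _ Sl)[]]] := regS.
apply: (ONan_of_spread_lines (proj1 regS) model (A := A) (p := p) (x := x)).
- by move=> i; apply: Sz.
- move=> i j /(graph_line_inj ind)[er es _ _]; apply/val_inj.
  by case: (ltngtP i j) => // /lt4 ij; case: (z_inj _ _ ij).
- move=> i; rewrite rpredDr ?u3H // (subvP lH) // rpredD // memvZ //.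
- move=> i j /lt4 ij; split; apply/span2P; exists (x1 i j), (x0 i j).
    rewrite /x -on_f // /p /inf_vec -/(ys i); vring.
  rewrite /x -on_f // meet_s // /yr meet_r // /p /inf_vec -/(ys j) -/(yr j); vring.
- move=> i j k l' /lt4 ij /lt4 kl E.
  have : x i j \in <[x k l']>%VS by rewrite -E memv_line.
  case/vlineP=> c xE.
  (* Both vectors have [u3] coordinate 1, which forces [c = 1]. *)
  have [|_ e0 e1 _ e3] := @ind (dr i + x1 i j * zr i + x0 i j * yr i -
      c * (dr k + x1 k l' * zr k + x0 k l' * yr k)) (x0 i j - c * x0 k l')
      (x1 i j - c * x1 k l') (tits_f m (x0 i j) (x1 i j) -
      c * tits_f m (x0 k l') (x1 k l')) (1 - c).
    rewrite -[RHS](subrr (x i j)) {2}xE /x; vring.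
  have cE : c = 1 by apply/esym/subr0_eq.
  have [] := x_inj i j k l' ij kl.
  - by apply: subr0_eq; rewrite -e0 cE mul1r.
  - by apply: subr0_eq; rewrite -e1 cE mul1r.
  by move=> /val_inj -> /val_inj ->.
by move=> i j P ij P1; apply: U_cone.
Qed.

End Configuration.

(** * Symmetries of the Tits ovoid *)

Section TitsFrame.

Variables (m : nat) (F : finFieldType).
Hypotheses (odd_m : odd m) (cardF : #|F| = (2 ^ m)%N).
Implicit Types (O : subspaces 'rV[F]_5) (w u : 'rV[F]_5).

(** With the ovoid described by a basis of its 3-space, a symmetry becomes a change of basis. *)
Definition tits_frame O u0 u1 u2 u3 := forall P, O P <->
  P = <[u2]>%VS \/
  exists x0 x1, P = <[x0 *: u0 + x1 *: u1 + tits_f m x0 x1 *: u2 + u3]>%VS.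

Lemma tits_frame_translate O w u0 u1 u2 u3 (a b : F) :
  independent5 w u0 u1 u2 u3 -> tits_frame O u0 u1 u2 u3 ->
  let at_ := a ^+ tits_exp m in
  let v0 := u0 + at_ *: u1 + (b + at_ * a) *: u2 in
  let v1 := u1 + a *: u2 in
  let v3 := a *: u0 + b *: u1 + tits_f m a b *: u2 + u3 in
  independent5 w v0 v1 u2 v3 /\ tits_frame O v0 v1 u2 v3.
Proof.
move=> ind frame at_ v0 v1 v3; split=> [r x y z t E|P].
  have [|-> ex ey ez et] := @ind r (x + t * a) (x * at_ + y + t * b)
    (x * (b + at_ * a) + y * a + z + t * tits_f m a b) t.
    by rewrite -[RHS]E /v0 /v1 /v3; vring.
  by move: ex ey ez; rewrite et !mul0r !addr0 => ->; rewrite !mul0r !add0r => ->;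
    rewrite !mul0r !add0r => ->.
have vE x y : x *: v0 + y *: v1 + tits_f m x y *: u2 + v3 =
    (x + a) *: u0 + (y + b + at_ * x) *: u1
      + tits_f m (x + a) (y + b + at_ * x) *: u2 + u3.
  by rewrite (tits_f_translate odd_m cardF) /v0 /v1 /v3 -/at_; vring.
rewrite frame; split=> -[->|[x [y ->]]]; [by left | right | by left | right].
  exists (x - a), (y - b - at_ * (x - a)); rewrite vE.
  by rewrite (subrK a) (_ : _ - _ - _ + _ + _ = y) //; ring.
by exists (x + a), (y + b + at_ * x); rewrite vE.
Qed.

Lemma tits_frame_swap O w u0 u1 u2 u3 :
  independent5 w u0 u1 u2 u3 -> tits_frame O u0 u1 u2 u3 ->
  independent5 w u1 u0 u3 u2 /\ tits_frame O u1 u0 u3 u2.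
Proof.
move=> ind frame; split=> [r x y z t E|P].
  by have [|-> -> -> -> ->] := @ind r y x t z; rewrite -?[RHS]E; first vring.
have sw v0 v1 v2 v3 x y : tits_f m x y != 0 ->
    <[x *: v0 + y *: v1 + tits_f m x y *: v2 + v3]>%VS =
    <[(y / tits_f m x y) *: v1 + (x / tits_f m x y) *: v0
      + tits_f m (y / tits_f m x y) (x / tits_f m x y) *: v3 + v2]>%VS :> {vspace 'rV[F]_5}.
  move=> f0; rewrite (tits_f_invert odd_m cardF f0).
  set X := (X in _ = <[X]>%VS).
  have -> : x *: v0 + y *: v1 + tits_f m x y *: v2 + v3 = tits_f m x y *: X.
    by apply/rowP=> i; rewrite !mxE; field.
  apply/eqP; rewrite eqEsubv !vline_sub memvZ ?memv_line //=.
  by rewrite -{1}[X](scalerK f0) memvZ ?memv_line.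
have half v0 v1 v2 v3 : P = <[v2]>%VS \/ (exists x0 x1,
      P = <[x0 *: v0 + x1 *: v1 + tits_f m x0 x1 *: v2 + v3]>%VS) ->
    P = <[v3]>%VS \/ (exists x0 x1,
      P = <[x0 *: v1 + x1 *: v0 + tits_f m x0 x1 *: v3 + v2]>%VS).
  case=> [->|[x [y ->]]].
    right; exists 0, 0; by rewrite tits_f00 !scale0r !add0r.
  (* [f] vanishes only at the origin, whose point [<[v3]>] is the exceptional one in the swapped
     frame. *)
  have [fxy|f0] := eqVneq (tits_f m x y) 0; last by right; rewrite sw //; eexists; eexists.
  have [-> ->] := tits_f_eq0 odd_m cardF fxy; left.
  by rewrite tits_f00 !scale0r !add0r.
by rewrite frame; split; apply: half.
Qed.

(** A translation makes the given point the fourth basis point, and the swap then makes it the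
    third. *)
Lemma tits_frame_at O w u0 u1 u2 u3 Q :
  independent5 w u0 u1 u2 u3 -> tits_frame O u0 u1 u2 u3 -> O Q ->
  exists v0 v1 v2 v3,
    [/\ independent5 w v0 v1 v2 v3, tits_frame O v0 v1 v2 v3 & Q = <[v2]>%VS].
Proof.
move=> ind frame /frame[->|[a [b ->]]]; first by exists u0, u1, u2, u3.
have [ind' frame'] := tits_frame_translate a b ind frame.
have [ind2 frame2] := tits_frame_swap ind' frame'.
by eexists; eexists; eexists; eexists; split; [exact: ind2 | exact: frame2 |].
Qed.

Lemma is_tits_ovoid_frame (W : {vspace 'rV[F]_5}) O w :
  is_tits_ovoid m W O -> w \notin W ->
  exists u0 u1 u2 u3, [/\ independent5 w u0 u1 u2 u3, tits_frame O u0 u1 u2 u3,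
    W = (<[u0]> + <[u1]> + <[u2]> + <[u3]>)%VS & \dim W = 4%N].
Proof.
move=> [phi [kerphi <- OE]] wW.
pose e := @row4 F.
have eE a b c d : e a b c d =
    a *: e 1 0 0 0 + b *: e 0 1 0 0 + c *: e 0 0 1 0 + d *: e 0 0 0 1.
  by apply/rowP=> -[[|[|[|[|i]]]] hi] //; rewrite !mxE /=; ring.
have phiE a b c d : phi (e a b c d) = a *: phi (e 1 0 0 0)
    + b *: phi (e 0 1 0 0) + c *: phi (e 0 0 1 0) + d *: phi (e 0 0 0 1).
  by rewrite eE !linearD !linearZ.
exists (phi (e 1 0 0 0)), (phi (e 0 1 0 0)), (phi (e 0 0 1 0)), (phi (e 0 0 0 1)).
split.
- move=> r a b c d; rewrite -!addrA [X in _ + X]addrA [X in _ + X]addrA -phiE => E.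
  have r0 : r = 0.
    apply/eqP; apply: contraNT wW => r0.
    have -> : w = phi (- r^-1 *: e a b c d).
      rewrite linearZ /= -[LHS](scalerK r0) (eqP (_ : r *: w == - phi (e a b c d))).
        by rewrite scalerN scaleNr.
      by rewrite -addr_eq0 E.
    by rewrite memv_img ?memvf.
  have : e a b c d \in lker phi.
    by move: E; rewrite r0 scale0r add0r memv_ker => /eqP.
  rewrite kerphi memv0 => /eqP/rowP e0.
  have := e0 0; have := e0 1; have := e0 2; have := e0 3.
  by rewrite !mxE /= => -> -> -> ->.
- move=> P; rewrite OE; split=> [[Q [->|[x0 [x1 ->]]] ->]|[->|[x0 [x1 ->]]]].
  + by left; rewrite limg_line.
  + by right; exists x0, x1; rewrite limg_line -/(e _ _ _ _) (phiE x0) scale1r.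
  + by exists <[(e 0 0 1 0)%R]>%VS; [left | rewrite limg_line].
  + exists <[(e x0 x1 (tits_f m x0 x1) 1)%R]>%VS; first by right; exists x0, x1.
    by rewrite limg_line -/(e _ _ _ _) (phiE x0) scale1r.
- apply/eqP; rewrite eqEsubv !subv_add !vline_sub !memv_img ?memvf // !andbT.
  apply/subvP=> _ /memv_imgP[x _ ->].
  have -> : x = e (x 0 0) (x 0 1) (x 0 2) (x 0 3).
    by apply/rowP=> -[[|[|[|[|i]]]] hi] //; rewrite !mxE /=; congr (x _ _); apply/val_inj.
  by rewrite (phiE (x 0 0)) !memv_add // memvZ ?memv_line.
rewrite limg_dim_eq; last by rewrite kerphi capv0.
by rewrite dimvf dim_matrix.
Qed.

End TitsFrame.

(** * Position of the cone relative to the hyperplane at infinity *)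

Section ConeAtInfinity.

Variables (m : nat) (F : finFieldType).
Hypotheses (odd_m : odd m) (cardF : #|F| = (2 ^ m)%N).
Variables (H W l : {vspace 'rV[F]_5}) (O : subspaces 'rV[F]_5) (w : 'rV[F]_5).
Hypotheses (hypH : is_hyperplane H) (ovoidO : is_tits_ovoid m W O).
Hypotheses (w0 : w != 0) (wW : w \notin W) (l2 : is_line l) (lH : (l <= H)%VS).
Hypothesis cone_l : forall P, is_point P ->
  (cone <[w]>%VS O P /\ (P <= H)%VS <-> (P <= l)%VS).

(** Otherwise projection from [w] onto [H] would send the ovoid into [l]; the ovoid would lie in the
    plane [w + l], but it spans [W], of dimension 4. *)
Lemma cone_vertex_at_infinity : w \in H.
Proof.
have [u0 [u1 [u2 [u3 [_ frame WE W4]]]]] := is_tits_ovoid_frame ovoidO wW.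
apply: contraT => wH.
have Owl q : O <[q]>%VS -> q \in (<[w]> + l)%VS.
  move=> Oq; have [c qH] := hyperplane_complement q hypH wH.
  rewrite -(subrKC (c *: w) q) memv_add ?memvZ ?memv_line //.
  have [->|n0] := eqVneq (q - c *: w) 0; first exact: mem0v.
  rewrite -vline_sub; apply/(cone_l (vline_is_point n0)); rewrite vline_sub; split=> //.
  split; first exact: vline_is_point.
  exists <[q]>%VS => //; rewrite vline_sub addvC memv_add ?memv_line //.
  by rewrite rpredN memvZ ?memv_line.
have Ox x y : x *: u0 + y *: u1 + tits_f m x y *: u2 + u3 \in (<[w]> + l)%VS.
  by apply: Owl; apply/frame; right; exists x, y.
have u2wl : u2 \in (<[w]> + l)%VS by apply: Owl; apply/frame; left.
have u3wl : u3 \in (<[w]> + l)%VS.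
  by have := Ox 0 0; rewrite tits_f00 !scale0r !add0r.
have u0wl : u0 \in (<[w]> + l)%VS.
  have := Ox 1 0; rewrite scale1r scale0r addr0 !rpredDr ?memvZ //.
have u1wl : u1 \in (<[w]> + l)%VS.
  have := Ox 0 1; rewrite scale1r scale0r add0r !rpredDr ?memvZ //.
have : (W <= <[w]> + l)%VS by rewrite WE !subv_add !vline_sub u0wl u1wl u2wl u3wl.
move/dimvS; have := dimv_sum_cap <[w]>%VS l.
rewrite W4 dim_vline w0 l2 => E /leq_trans.
by move/(_ _ (leq_addr (\dim (<[w]> :&: l)) _)); rewrite E.
Qed.

(** The line [l] joins [w] to an ovoid point, which is moved to [u2]. Any other ovoid point in [H]
    would lie on [l], against independence. *)
Lemma cone_frame_at_infinity : exists u0 u1 u2 u3,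
  [/\ independent5 w u0 u1 u2 u3, tits_frame m O u0 u1 u2 u3
    & [/\ w \in l, u2 \in l, u0 \in H, u1 \in H
        & forall x y, x *: u0 + y *: u1 + tits_f m x y *: u2 + u3 \notin H]].
Proof.
have [u0 [u1 [u2 [u3 [ind0 frame0 _ _]]]]] := is_tits_ovoid_frame ovoidO wW.
have wH := cone_vertex_at_infinity.
have wl : w \in l.
  rewrite -vline_sub; apply/(cone_l (vline_is_point w0)); rewrite vline_sub.
  split=> //; split; first exact: vline_is_point.
  by exists <[u2]>%VS; [apply/frame0; left | rewrite addvSl].
have [x xl xw] : exists2 x, x \in l & x \notin <[w]>%VS.
  by apply/subvPn/negP=> /dimvS; rewrite l2 dim_vline w0.
have x0 : x != 0 by apply: contraNneq xw => ->; rewrite mem0v.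
have [Q OQ Ql] : exists2 Q, O Q & (Q <= l)%VS.
  have : (<[x]> <= l)%VS by rewrite vline_sub.
  case/(cone_l (vline_is_point x0)) => -[_ [Q OQ xQ]] _; exists Q => //.
  have [q QE] : exists q, Q = <[q]>%VS.
    by case/frame0: OQ => [->|[y0 [y1 ->]]]; eexists.
  move: xQ; rewrite QE !vline_sub => /span2P[a [b xE]].
  have b0 : b != 0.
    by apply: contraNneq xw => b0; rewrite xE b0 scale0r addr0 memvZ ?memv_line.
  have -> : q = b^-1 *: (x - a *: w) by rewrite xE addrAC subrr add0r scalerK.
  by rewrite memvZ // rpredB // memvZ.
have [v0 [v1 [v2 [v3 [ind frame QE]]]]] := tits_frame_at odd_m cardF ind0 frame0 OQ.
have v2l : v2 \in l by rewrite -vline_sub -QE.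
have v2H : v2 \in H by rewrite (subvP lH).
have lE : l = (<[w]> + <[v2]>)%VS.
  apply: is_line_span => // a b E; have [] := @ind a 0 0 b 0 => //.
  rewrite -[RHS]E; vring.
have ovH y0 y1 : y0 *: v0 + y1 *: v1 + tits_f m y0 y1 *: v2 + v3 \notin H.
  set o := _ + v3; have oE (a b : F) : o <> a *: w + b *: v2.
    move=> E; have [|_ _ _ _ /eqP] := @ind (- a) y0 y1 (tits_f m y0 y1 - b) 1.
      rewrite -[RHS](subrr o) {2}E /o; vring.
    by rewrite oner_eq0.
  have o0 : o != 0.
    by apply/eqP=> E; apply: (oE 0 0); rewrite E !scale0r addr0.
  apply/negP=> oH; have : (<[o]> <= l)%VS.
    apply/(cone_l (vline_is_point o0)); rewrite vline_sub; split=> //.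
    split; first exact: vline_is_point.
    by exists <[o]>%VS; [apply/frame; right; exists y0, y1 | rewrite addvSr].
  by rewrite vline_sub lE => /span2P[a [b /oE]].
have v3H : v3 \notin H by have := ovH 0 0; rewrite tits_f00 !scale0r !add0r.
(* For [u] outside [H], some [c *: u + v3] is in [H], and adding [d] keeps it there. For [u = v0] or
   [v1], a suitable multiple [d] of [v2] turns it into an ovoid point, which is not in [H]. *)
have inH u : (forall c, exists2 d, d \in H & c *: u + d + v3 \notin H) -> u \in H.
  move=> hu; have [c ucH] := hyperplane_complement u hypH v3H.
  have [c0|c0] := eqVneq c 0; first by move: ucH; rewrite c0 scale0r subr0.
  have [d dH /negP[]] := hu (- c^-1).
  rewrite addrAC rpredDr // (_ : _ + _ = - c^-1 *: (u - c *: v3)) ?memvZ //.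
  by rewrite scalerBr !scaleNr opprK scalerK.
exists v0, v1, v2, v3; split=> //; split=> //; apply: inH => c.
  exists (tits_f m c 0 *: v2); first by rewrite memvZ.
  by have := ovH c 0; rewrite scale0r addr0.
exists (tits_f m 0 c *: v2); first by rewrite memvZ.
by have := ovH 0 c; rewrite scale0r add0r.
Qed.

End ConeAtInfinity.

Local Close Scope ring_scope.

Theorem theorem4p1 (m : nat) (F K : finFieldType) (U : subspaces 'rV[K]_3) :
  1 < m -> odd m -> #|F| = 2 ^ m -> #|K| = (2 ^ m) ^ 2 ->
  is_buekenhout_tits_unital F m U ->
  contains_ONan_configuration U.
Proof.
move=> m_gt1 odd_m cardF _ [H [S [beta [W [O [v [l]]]]]]].
move=> [[hypH regS model] [[_ ovoidO v1 vW] [Sl cone_l UE]]].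
have [w w0 vE] := is_pointP v1; subst v.
have wW : w \notin W by rewrite -vline_sub; apply/negP.
have [l2 lH] : is_line l /\ (l <= H)%VS by have [[/(_ _ Sl)]] := regS.
have [u0 [u1 [u2 [u3 [ind frame [wl u2l u0H u1H ovH]]]]]] :=
  cone_frame_at_infinity odd_m cardF hypH ovoidO w0 wW l2 lH cone_l.
have u3H : u3 \notin H by have := ovH 0%R 0%R; rewrite tits_f00 !scale0r !add0r.
apply: (ONan_of_frame m_gt1 odd_m cardF ind hypH regS Sl model wl u2l u0H u1H u3H).
move=> P r x0 x1 P1 bP; apply/UE; split=> //; left; rewrite bP.
rewrite -!addrA (addrA (x0 *: u0)%R) (addrA (_ + _)%R).
(* The vector is a multiple of [w] plus the ovoid vector [o]: it is on the cone, and affine because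
   [o] is. *)
set o := (_ + u3)%R; have oH : (r *: w + o)%R \notin H.
  by rewrite rpredDl ?ovH // memvZ // (subvP lH).
split; last by rewrite vline_sub; apply/negP.
split.
  by apply: vline_is_point; apply: contraNneq oH => ->; rewrite mem0v.
exists <[o]>%VS; first by apply/frame; right; exists x0, x1.
by rewrite vline_sub memv_add ?memvZ ?memv_line.
Qed.
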